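(* In the $\mathbb{Q}$-algebra $\mathcal{A}$, \[ \gamma_{\mathcal{A}}^{\mathrm{M}} = \gamma_{\mathcal{A}}^{\mathrm{W}} + \ell_{\mathcal{A}}(2) - 1 . \]
   Context: Throughout, $p$ denotes a prime number and $\mathbb{Z}_{(p)}$ the localization of $\mathbb{Z}$ at the prime ideal $(p)$; $\mathbb{Z}/p\mathbb{Z}$ is identified with $\mathbb{Z}_{(p)}/p\mathbb{Z}_{(p)}$. The ring $\mathcal{A}$ is the quotient ring $\mathcal{A} := \left(\prod_p \mathbb{Z}/p\mathbb{Z}\right)/\left(\bigoplus_p \mathbb{Z}/p\mathbb{Z}\right)$, where $p$ runs over all primes. An element of $\mathcal{A}$ is written $(a_p \bmod p)_p$; it is determined by its components for all but finitely many $p$, so finitely many $p$-components may be ignored or left undefined. $\mathbb{Q}$ is embedded diagonally in $\mathcal{A}$ (a rational number $r$ is sent to $(r \bmod p)_p$, ignoring the primes dividing its denominator), and $\mathcal{A}$ is thereby a $\mathbb{Q}$-algebra. Wilson quotient: $W_p := \dfrac{(p-1)!+1}{p}\in\mathbb{Z}$, and $\gamma_{\mathcal{A}}^{\mathrm{W}} := (W_p \bmod p)_p\in\mathcal{A}$. Gregory coefficients: the rational numbers $G_n$ ($n\ge 1$) are defined by $\dfrac{x}{\log(1+x)} = 1+\sum_{n=1}^\infty G_n x^n$. For $1\le n\le p-2$ the number $G_n$ lies in $\mathbb{Z}_{(p)}$. One defines $\gamma_{\mathcal{A}}^{\mathrm{M}} := \left(\sum_{n=1}^{p-2}\dfrac{|G_n|}{n}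 \bmod p\right)_p\in\mathcal{A}$, where $|\cdot|$ is the usual absolute value. Fermat quotient: for a non-zero rational number $x$ whose numerator and denominator are both prime to $p$, $q_p(x) := \dfrac{x^{p-1}-1}{p}\in\mathbb{Z}_{(p)}$. For $x\in\mathbb{Q}^\times$, $\log_{\mathcal{A}}(x) := (q_p(x)\bmod p)_p\in\mathcal{A}$ and $\ell_{\mathcal{A}}(x) := x\log_{\mathcal{A}}(x)\in\mathcal{A}$. *)

(* Defs.v *)
From HB Require Import structures.
From mathcomp Require Import all_boot all_order all_algebra.
From mathcomp Require Import mathcomp_extra boolp classical_sets functions cardinality.

Set Implicit Arguments.
Unset Strict Implicit.
Unset Printing Implicit Defensive.

Import Order.TTheory GRing.Theory Num.Theory.
Local Open Scope ring_scope.
Local Open Scope classical_set_scope.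

Definition prime_nat := {p : nat | prime p}.

Definition prodFp := forall p : prime_nat, 'F_(val p).

HB.instance Definition _ := gen_eqMixin prodFp.
HB.instance Definition _ := gen_choiceMixin prodFp.

Section ProductRing.
Implicit Types a b c : prodFp.

Let zero : prodFp := fun _ => 0.
Let one : prodFp := fun _ => 1.
Let opp a : prodFp := fun p => - a p.
Let add a b : prodFp := fun p => a p + b p.
Let mul a b : prodFp := fun p => a p * b p.

Fact prodFp_addA : associative add.
Proof. by move=> a b c; apply: functional_extensionality_dep => p; exact: addrA. Qed.
Fact prodFp_addC : commutative add.
Proof. by move=> a b; apply: functional_extensionality_dep => p; exact: addrC. Qed.
Fact prodFp_add0 : left_id zero add.
Proof. by move=> a; apply: functional_extensionality_dep => p; exact: add0r. Qed.
Fact prodFp_addN : left_inverse zero opp add.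
Proof. by move=> a; apply: functional_extensionality_dep => p; exact: addNr. Qed.

HB.instance Definition _ :=
  GRing.isZmodule.Build prodFp prodFp_addA prodFp_addC prodFp_add0 prodFp_addN.

Fact prodFp_mulA : associative mul.
Proof. by move=> a b c; apply: functional_extensionality_dep => p; exact: mulrA. Qed.
Fact prodFp_mulC : commutative mul.
Proof. by move=> a b; apply: functional_extensionality_dep => p; exact: mulrC. Qed.
Fact prodFp_mul1 : left_id one mul.
Proof. by move=> a; apply: functional_extensionality_dep => p; exact: mul1r. Qed.
Fact prodFp_mulDl : left_distributive mul add.
Proof. by move=> a b c; apply: functional_extensionality_dep => p; exact: mulrDl. Qed.
Fact prodFp_oner_neq0 : one != 0.
Proof.
apply/eqP => /(congr1 (fun a : prodFp => a (exist _ 2%N isT))) /eqP.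
by rewrite (negPf (oner_neq0 _)).
Qed.

HB.instance Definition _ := GRing.Zmodule_isComNzRing.Build prodFp
  prodFp_mulA prodFp_mulC prodFp_mul1 prodFp_mulDl prodFp_oner_neq0.

End ProductRing.

(** The direct sum of the Z/pZ, as an ideal of their product. *)
Definition sumFp : {pred prodFp} :=
  fun a => `[< finite_set [set p | a p != 0] >].

Lemma finite_prime_natP (S : set prime_nat) :
  finite_set S <-> exists N, forall p, S p -> (val p <= N)%N.
Proof.
split=> [/finite_seqP[s ->]|[N SN]].
  exists (\max_(p <- s) val p)%N => p ps.
  by rewrite (big_rem p) //= leq_maxl.
apply: (@sub_finite_set _ _ (val @^-1` `I_N.+1)) => [p /SN //|].
by apply: finite_preimage; [move=> p q _ _; exact: val_inj | exact: finite_II].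
Qed.

Fact sumFp_idealr_closed : idealr_closed sumFp.
Proof.
split.
- apply/asboolP; rewrite (_ : [set p | _] = set0) //.
  by apply/seteqP; split=> p //=; rewrite eqxx.
- apply/asboolP => /finite_prime_natP[N oneN].
  have [q Nq q_prime] := prime_above N.
  have := oneN (exist _ q q_prime) (oner_neq0 _).
  by rewrite leqNgt Nq.
- move=> a u v /asboolP u_fin /asboolP v_fin; apply/asboolP.
  apply: (@sub_finite_set _ _ ([set p | u p != 0] `|` [set p | v p != 0])).
    move=> p /=; case: (eqVneq (u p) 0) => [up0|]; last by left.
    case: (eqVneq (v p) 0) => [vp0|]; last by right.
    by rewrite -[(a * u + v) p]/(a p * u p + v p) up0 vp0 mulr0 addr0 eqxx.
  by rewrite finite_setU.
Qed.

HB.instance Definition _ := isIdealr.Build prodFp sumFp sumFp_idealr_closed.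

Definition ringA := {ideal_quot sumFp}.
HB.instance Definition _ := GRing.ComNzRing.on ringA.

Definition mkA (a : prodFp) : ringA := \pi_ringA%qT a.

Lemma mkA_eqP (a b : prodFp) :
  mkA a = mkA b <-> finite_set [set p | a p != b p].
Proof.
have -> : [set p | a p != b p] = [set p | (a - b) p != 0].
  by apply/seteqP; split=> p /=; rewrite -[(a - b) p]/(a p - b p) subr_eq0.
split=> [/eqP|fin_ab]; last by apply/eqP; rewrite -Quotient.idealrBE; apply/asboolP.
by rewrite -Quotient.idealrBE => /asboolP.
Qed.

Lemma mkA_eq_large N (a b : prodFp) :
  (forall p, (N < val p)%N -> a p = b p) -> mkA a = mkA b.
Proof.
move=> ab; apply/mkA_eqP/finite_prime_natP; exists N => p /=.
by apply: contraNT; rewrite -ltnNge => /ab/eqP.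
Qed.

Lemma mkAB a b : mkA (a - b) = mkA a - mkA b.
Proof. exact: rmorphB. Qed.
Lemma mkAM a b : mkA (a * b) = mkA a * mkA b.
Proof. exact: rmorphM. Qed.
Lemma mkA1 : mkA 1 = 1.
Proof. exact: rmorph1. Qed.

(** Reduction modulo p.  On Z_(p) this is the canonical ring morphism
    Z_(p) -> Z/pZ, see [redp_frac]; when p divides the denominator of [x] it
    takes the junk value 0 (as 0^-1 = 0 in 'F_p). *)
Definition redp (p : nat) (x : rat) : 'F_p := ratr x.

Lemma redp_frac (p : nat) (m n : int) : (n%:~R : 'F_p) != 0 ->
  redp p (m%:~R / n%:~R) = m%:~R / n%:~R.
Proof.
move=> n_neq0; set x : rat := _ / _.
have n0 : n != 0 by apply: contraNneq n_neq0 => ->.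
have xE : numq x * n = m * denq x.
  apply/eqP; rewrite -(eqr_int rat) !intrM -eqr_div ?intr_eq0 ?denq_neq0 //.
  by rewrite divq_num_den.
have dn : (denq x %| n)%Z.
  rewrite -(Gauss_dvdzr _ (_ : coprimez (denq x) (numq x))); last first.
    by rewrite coprimez_sym /coprimez /gcdz; exact: coprime_num_den.
  by rewrite xE dvdz_mull.
have d_neq0 : ((denq x)%:~R : 'F_p) != 0.
  by case/dvdzP: dn n_neq0 => k ->; rewrite intrM mulf_eq0 negb_or => /andP[].
by apply/eqP; rewrite /redp /ratr eqr_div // -!intrM xE.
Qed.

Definition ratA (x : rat) : ringA := mkA (fun p => redp (val p) x).

Lemma Fp_int_neq0 (p : prime_nat) (n : int) : n != 0 -> (`|n| < val p)%N ->
  (n%:~R : 'F_(val p)) != 0.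
Proof.
move=> n0 np; have p_char := pchar_Fp (valP p).
suff : (`|n|%N%:R : 'F_(val p)) != 0.
  by case: (intP n) => [|k|k]; rewrite ?abszN ?rmorphN ?oppr_eq0.
by rewrite -(dvdn_pcharf p_char) gtnNdvd // absz_gt0.
Qed.

Fact ratA_is_zmod_morphism : zmod_morphism ratA.
Proof.
move=> x y; rewrite -mkAB; apply: (@mkA_eq_large (`|denq x| + `|denq y|)) => p ltp.
have dx : ((denq x)%:~R : 'F_(val p)) != 0.
  by apply: Fp_int_neq0; rewrite ?denq_neq0 // (leq_ltn_trans _ ltp) ?leq_addr.
have dy : ((denq y)%:~R : 'F_(val p)) != 0.
  by apply: Fp_int_neq0; rewrite ?denq_neq0 // (leq_ltn_trans _ ltp) ?leq_addl.
have -> : x - y = (numq x * denq y - numq y * denq x)%:~R / (denq x * denq y)%:~R.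
  rewrite -[x in LHS]divq_num_den -[y in LHS]divq_num_den -mulNr addf_div ?intr_eq0 ?denq_neq0 //.
  by rewrite mulNr -!intrM -intrB.
rewrite redp_frac ?intrM ?mulf_neq0 // -[RHS]/(redp _ x - redp _ y) /redp /ratr.
by rewrite -[in RHS]mulNr addf_div // mulNr -!intrM -intrB.
Qed.

Fact ratA_is_monoid_morphism : monoid_morphism ratA.
Proof.
split=> [|x y].
  by rewrite /ratA -mkA1; congr mkA; apply: functional_extensionality_dep => p;
    rewrite /redp /ratr divr1.
rewrite -mkAM; apply: (@mkA_eq_large (`|denq x| + `|denq y|)) => p ltp.
have dx : ((denq x)%:~R : 'F_(val p)) != 0.
  by apply: Fp_int_neq0; rewrite ?denq_neq0 // (leq_ltn_trans _ ltp) ?leq_addr.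
have dy : ((denq y)%:~R : 'F_(val p)) != 0.
  by apply: Fp_int_neq0; rewrite ?denq_neq0 // (leq_ltn_trans _ ltp) ?leq_addl.
have -> : x * y = (numq x * numq y)%:~R / (denq x * denq y)%:~R.
  by rewrite !intrM -mulf_div !divq_num_den.
by rewrite redp_frac ?intrM ?mulf_neq0 // -mulf_div.
Qed.

HB.instance Definition _ := GRing.isZmodMorphism.Build rat ringA ratA
  ratA_is_zmod_morphism.
HB.instance Definition _ := GRing.isMonoidMorphism.Build rat ringA ratA
  ratA_is_monoid_morphism.

Section RatAlgebra.
Let scale (x : rat) (u : ringA) : ringA := ratA x * u.

Fact ringA_scaleA x y u : scale x (scale y u) = scale (x * y) u.
Proof. by rewrite /scale rmorphM mulrA. Qed.
Fact ringA_scale1 : left_id 1 scale.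
Proof. by move=> u; rewrite /scale rmorph1 mul1r. Qed.
Fact ringA_scaleDr : right_distributive scale +%R.
Proof. by move=> x u v; exact: mulrDr. Qed.
Fact ringA_scaleDl u : {morph scale^~ u : x y / x + y}.
Proof. by move=> x y; rewrite /scale rmorphD mulrDl. Qed.

HB.instance Definition _ := GRing.Zmodule_isLmodule.Build rat ringA
  ringA_scaleA ringA_scale1 ringA_scaleDr ringA_scaleDl.

Fact ringA_scaleAl (x : rat) (u v : ringA) : x *: (u * v) = (x *: u) * v.
Proof. exact: mulrA. Qed.
HB.instance Definition _ := GRing.Lmodule_isLalgebra.Build rat ringA ringA_scaleAl.

Fact ringA_scaleAr (x : rat) (u v : ringA) : x *: (u * v) = u * (x *: v).
Proof. exact: mulrCA. Qed.
HB.instance Definition _ := GRing.Lalgebra_isAlgebra.Build rat ringA ringA_scaleAr.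
End RatAlgebra.

Lemma ringA_scaleE (x : rat) (u : ringA) : x *: u = ratA x * u.
Proof. by []. Qed.

(** Formal power series over Q, as sequences of coefficients. *)
Definition fps := nat -> rat.

Definition fps_mul (a b : fps) : fps :=
  fun n => \sum_(k < n.+1) a k * b (n - k)%N.

(** The first [n] coefficients of 1 / a, for a 0 != 0. *)
Fixpoint fps_inv_seq (a : fps) (n : nat) : seq rat :=
  if n is m.+1 then
    let s := fps_inv_seq a m in
    rcons s (((m == 0)%:R - \sum_(k < m) s`_k * a (m - k)%N) / a 0)
  else [::].

Definition fps_inv (a : fps) : fps := fun n => (fps_inv_seq a n.+1)`_n.

Definition fps_one : fps := fun n => (n == 0)%:R.
Definition fps_X : fps := fun n => (n == 1)%:R.

(** The Mercator series of log (1 + x). *)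
Definition fps_log1p : fps :=
  fun n => if n is m.+1 then (-1) ^+ m / m.+1%:R else 0.

(** The Gregory coefficients: the expansion of x / log (1 + x), that is, of
    the inverse of log (1 + x) / x. *)
Definition gregory : nat -> rat := fps_inv (fun n => fps_log1p n.+1).

Lemma size_fps_inv_seq a n : size (fps_inv_seq a n) = n.
Proof. by elim: n => //= n IHn; rewrite size_rcons IHn. Qed.

Lemma nth_fps_inv_seq a n k : (k < n)%N -> (fps_inv_seq a n)`_k = fps_inv a k.
Proof.
elim: n => // n IHn; rewrite ltnS leq_eqVlt => /orP[/eqP->//|ltkn].
by rewrite /= nth_rcons size_fps_inv_seq ltkn IHn.
Qed.

Lemma fps_invE a n : fps_inv a n =
  ((n == 0)%:R - \sum_(k < n) fps_inv a k * a (n - k)%N) / a 0.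
Proof.
rewrite /fps_inv /= nth_rcons size_fps_inv_seq ltnn eqxx; congr ((_ - _) / _).
by apply: eq_bigr => k _; rewrite nth_fps_inv_seq.
Qed.

Lemma fps_mulVf a : a 0 != 0 -> fps_mul (fps_inv a) a = fps_one.
Proof.
move=> a0; apply/funext => n; rewrite /fps_mul big_ord_recr /= subnn.
by rewrite [fps_inv a n]fps_invE divfK // addrC subrK.
Qed.

(** (1 + sum_(n >= 1) G_n x^n) log (1 + x) = x, and this determines G. *)
Lemma gregory0 : gregory 0 = 1.
Proof. by rewrite /gregory fps_invE big_ord0. Qed.

Lemma gregoryP : fps_mul gregory fps_log1p = fps_X.
Proof.
apply/funext => -[|n]; rewrite /fps_mul; first by rewrite big_ord_recr big_ord0 /= mulr0.
rewrite big_ord_recr /= subnn mulr0 addr0.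
have := congr1 (fun a : fps => a n) (@fps_mulVf (fun n => fps_log1p n.+1) isT).
rewrite /fps_mul /fps_one /fps_X eqSS => <-.
by apply: eq_bigr => k _; rewrite subSn // -ltnS.
Qed.

Lemma gregory_unique (g : fps) : fps_mul g fps_log1p = fps_X -> g = gregory.
Proof.
move=> gP; apply/funext => n; elim/ltn_ind: n => n IHn.
have := congr1 (fun a : fps => a n.+1) (etrans gP (esym gregoryP)).
rewrite /fps_mul !big_ord_recr /= subnn !mulr0 !addr0 subSnn /= !mulr1.
rewrite (eq_bigr (fun k : 'I_n => gregory k * fps_log1p (n.+1 - k)%N)); last first.
  by move=> k _; rewrite IHn.
by apply: addrI.
Qed.

(** The division is exact, see [wilson_quotientK]. *)
Definition wilson_quotient (p : nat) : nat := ((p.-1)`!.+1 %/ p)%N.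

Lemma wilson_quotientK (p : nat) : prime p ->
  (wilson_quotient p * p = (p.-1)`!.+1)%N.
Proof. by move=> p_prime; rewrite divnK // -Wilson // prime_gt1. Qed.

Definition gammaW : ringA := mkA (fun p => (wilson_quotient (val p))%:R).

(** The sum is taken in Q, where the absolute value makes sense, and then
    reduced; it lies in Z_(p), as G_n does for n <= p - 2. *)
Definition gammaM : ringA :=
  mkA (fun p => redp (val p) (\sum_(1 <= n < (val p).-1) `|gregory n| / n%:R)).

Definition fermat_quotient (p : nat) (x : rat) : rat := (x ^+ p.-1 - 1) / p%:R.

(** [x] is meant to be non-zero.  The Fermat quotient lies in Z_(p) for all
    but the finitely many p that divide the numerator or denominator of [x]. *)
Definition logA (x : rat) : ringA :=
  mkA (fun p => redp (val p) (fermat_quotient (val p) x)).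

Definition ellA (x : rat) : ringA := x *: logA x.

(* Main.v *)
Require Import Defs.
From mathcomp Require Import all_boot all_order all_algebra all_field.
From mathcomp Require Import ring zify.
From mathcomp Require Import boolp.
Import Order.TTheory GRing.Theory Num.Theory.
Local Open Scope ring_scope.

(** The equality is proved componentwise, as a congruence modulo each odd prime
    p.

    The series -x / log (1 - x) has coefficients (-1)^n G_n and is the reciprocal
    of sum_n x^n / (n + 1). The coefficients 1 / (n + 1) are log-convex, so by
    Kaluza's theorem |G_n| = - (-1)^n G_n for n >= 1 ([gregory_sign]). The
    coefficient of x^p in (-x / log (1 - x)) (- log (1 - x)) = x gives
      1 / p + sum_(1 <= n <= p - 2) (-1)^n G_n / (p - n) + G_(p-1) = 0.
    Since 1 / (p - n) is -1 / n modulo p, the middle sum is congruent to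
    S = sum_(1 <= n <= p - 2) |G_n| / n, so S is congruent to - 1 / p - G_(p-1).

    On the other hand G_n is the integral from 0 to 1 of binom(t, n)
    ([gregory_integral]). Writing s_j for the coefficients of
    t (t - 1) ... (t - p + 2), this reads
      (p - 1)! G_(p-1) = 1 / p + sum_(1 <= j <= p - 2) s_j / (j + 1).
    Hence - (p - 1)! S is congruent to
    ((p - 1)! + 1) / p + sum_(1 <= j <= p - 2) s_j / (j + 1), in which the first
    term is the Wilson quotient ([gregory_truncated_sum]). Modulo p one has
    (p - 1)! = -1 and s_j = (-1)^j, because the product above is
    (t^p - t) / (t + 1). So S is congruent to
      W_p + sum_(1 <= j <= p - 2) (-1)^j / (j + 1),
    and the last sum is 2 q_p(2) - 1, by the classical expansion
      2 q_p(2) = (2^p - 2) / p = sum_(0 <= j <= p - 2) C(p - 1, j) / (j + 1)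
    together with C(p - 1, j) = (-1)^j modulo p
    ([reduces_fermat_quotient2]). *)

(** * Falling factorials and binomial polynomials *)

Definition falling (R : nzRingType) (n : nat) : {poly R} :=
  \prod_(i < n) ('X - i%:R%:P).

Lemma fallingS (R : comNzRingType) n :
  falling R n.+1 = ('X - n%:R%:P) * falling R n.
Proof. by rewrite /falling big_ord_recr mulrC. Qed.

Lemma size_falling (R : idomainType) n : size (falling R n) = n.+1.
Proof. by rewrite /falling size_prod_XsubC [index_enum _]unlock -enumT size_enum_ord. Qed.

Lemma monic_falling (R : nzRingType) n : falling R n \is monic.
Proof. exact: monic_prod_XsubC. Qed.

Lemma map_falling (R S : nzRingType) (f : {rmorphism R -> S}) n :
  map_poly f (falling R n) = falling S n.
Proof.
rewrite /falling rmorph_prod; apply: eq_bigr => i _.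
by rewrite rmorphB /= map_polyX map_polyC /= rmorph_nat.
Qed.

Definition binom_poly (n : nat) : {poly rat} := n`!%:R^-1 *: falling rat n.

Lemma binom_polyS n :
  n.+1%:R *: binom_poly n.+1 = ('X - n%:R%:P) * binom_poly n.
Proof.
rewrite /binom_poly fallingS scalerA factS natrM invfM mulrA mulfV ?mul1r.
  by rewrite scalerAr.
by rewrite pnatr_eq0.
Qed.

Lemma log1p_natmul n : n.+1%:R * fps_log1p n.+1 = (-1) ^+ n.
Proof. by rewrite /= mulrC divfK ?pnatr_eq0. Qed.

(** The derivative in t of (1 + x)^t = sum_n binom(t, n) x^n is
    log (1 + x) (1 + x)^t; this is the coefficient of x^n. Differentiating
    [binom_polyS] gives an induction on n, which the right side also satisfies
    because m times the coefficient of x^m in log (1 + x) is a sign. *)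
Lemma deriv_binom_poly n :
  (binom_poly n)^`() = \sum_(k < n) fps_log1p (n - k)%N *: binom_poly k.
Proof.
elim: n => [|n IHn].
  by rewrite big_ord0 /binom_poly /falling big_ord0 derivZ derivC scaler0.
have n1 : n.+1%:R != 0 :> rat by rewrite pnatr_eq0.
apply: (scalerI n1); rewrite -derivZ binom_polyS derivM derivXsubC mul1r IHn.
rewrite mulr_sumr scaler_sumr.
(* Rewrite X - n as (X - k) - (n - k) in each term. *)
transitivity (binom_poly n + \sum_(k < n)
   ((fps_log1p (n - k)%N * k.+1%:R) *: binom_poly k.+1
     - ((n - k)%N%:R * fps_log1p (n - k)%N) *: binom_poly k)).
  congr (_ + _); apply: eq_bigr => k _.
  have -> : 'X - n%:R%:P = 'X - k%:R%:P - (n - k)%N%:R%:P :> {poly rat}.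
    by rewrite natrB 1?ltnW // rmorphB /= opprB addrA subrK.
  rewrite -scalerAr mulrBl -binom_polyS mul_polyC scalerBr !scalerA.
  by rewrite [_ * (n - k)%N%:R]mulrC.
(* On the right, split n + 1 as k + (n + 1 - k). *)
transitivity (\sum_(k < n.+1) (k%:R * fps_log1p (n.+1 - k)%N) *: binom_poly k +
   \sum_(k < n.+1) ((n.+1 - k)%N%:R * fps_log1p (n.+1 - k)%N) *: binom_poly k).
  rewrite [X in _ = X + _]big_ord_recl mul0r scale0r add0r.
  rewrite [X in _ = _ + X]big_ord_recr /= subSnn log1p_natmul expr0 scale1r.
  rewrite addrA [RHS]addrC; congr (_ + _).
  rewrite -big_split; apply: eq_bigr => k _ /=.
  rewrite -scaleNr /bump add1n subSS [k.+1%:R * _]mulrC; congr (_ + _ *: _).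
  rewrite subSn 1?ltnW //; have -> : (n - k = (n - k).-1.+1)%N by have := ltn_ord k; lia.
  by rewrite !log1p_natmul exprS mulN1r.
rewrite -big_split; apply: eq_bigr => k _ /=.
rewrite -scalerDl -mulrDl -natrD subnKC ?scalerA //.
by rewrite ltnW.
Qed.

(** * Gregory coefficients as integrals of binomial polynomials *)

(** The integral from 0 to 1, read off the coefficients, so that it also makes
    sense over a field of positive characteristic when the degree is small. *)
Definition int01 (F : fieldType) (P : {poly F}) : F :=
  \sum_(j < size P) P`_j / j.+1%:R.

Arguments int01 {F} P.

Lemma int01E (F : fieldType) (P : {poly F}) n : (size P <= n)%N ->
  int01 P = \sum_(j < n) P`_j / j.+1%:R.
Proof.
move=> le_n; rewrite /int01 (big_ord_widen n (fun j => P`_j / j.+1%:R)) //.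
rewrite big_mkcond; apply: eq_bigr => j _.
by case: ltnP => // /leq_sizeP ->; rewrite // mul0r.
Qed.

Lemma int01Z (F : fieldType) c (P : {poly F}) : int01 (c *: P) = c * int01 P.
Proof.
rewrite (@int01E F (c *: P) (size P)) ?size_scale_leq // mulr_sumr.
by apply: eq_bigr => j _; rewrite coefZ mulrA.
Qed.

Lemma int01_sum (F : fieldType) (I : Type) (r : seq I) (P : I -> {poly F}) :
  int01 (\sum_(i <- r) P i) = \sum_(i <- r) int01 (P i).
Proof.
apply: (big_morph int01) => [P1 P2|]; last by rewrite /int01 size_poly0 big_ord0.
pose m := maxn (size P1) (size P2).
rewrite (@int01E F P1 m) ?(@int01E F P2 m) ?(@int01E F (P1 + P2) m) ?leq_maxl ?leq_maxr //.
  by rewrite -big_split; apply: eq_bigr => j _; rewrite coefD mulrDl.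
exact: size_polyD.
Qed.

Lemma int01_deriv (F : numFieldType) (P : {poly F}) : int01 P^`() = P.[1] - P.[0].
Proof.
rewrite (@int01E _ _ (size P)) ?(leq_trans (leq_sizeP _ _ _)) //; last first.
  by apply/leq_sizeP => j lej; rewrite coef_deriv nth_default ?mul0rn // ltnW.
rewrite horner_coef0 (@horner_coef_wide _ (size P).+1) // big_ord_recl.
rewrite expr0 mulr1 addrC addKr; apply: eq_bigr => j _.
by rewrite expr1n mulr1 coef_deriv -[P`_ _ *+ _]mulr_natr mulfK ?pnatr_eq0.
Qed.

Lemma binom_poly_diff n : (binom_poly n).[1] - (binom_poly n).[0] = (n == 1)%:R.
Proof.
rewrite /binom_poly !hornerZ /falling !horner_prod.
case: n => [|[|n]]; first by rewrite !big_ord0 subrr.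
  by rewrite !big_ord1 !hornerXsubC subrr mulr0 !subr0 invr1 mulr1.
rewrite (bigD1 (Ordinal (isT : 1 < n.+2))%N) //=.
by rewrite [X in _ - _ * X](bigD1 ord0) //= !hornerXsubC !subrr !mul0r !mulr0 subr0.
Qed.

(** Integrating (1 + x)^t over t in [0, 1] gives x / log (1 + x). Formally:
    multiplying the integrated series by log (1 + x) integrates the derivatives
    [deriv_binom_poly], which leaves binom(1, n) - binom(0, n). *)
Lemma gregory_integral n : gregory n = int01 (binom_poly n).
Proof.
suff E : (fun n => int01 (binom_poly n)) = gregory by rewrite -E.
apply: gregory_unique; apply/funext => {}n.
rewrite /fps_mul big_ord_recr /= subnn mulr0 addr0.
rewrite /fps_X -binom_poly_diff -int01_deriv deriv_binom_poly.
rewrite int01_sum.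
by apply: eq_bigr => k _; rewrite [RHS]int01Z mulrC.
Qed.

Lemma gregory_falling n : gregory n = int01 (falling rat n) / n`!%:R.
Proof. by rewrite gregory_integral /binom_poly int01Z mulrC. Qed.

(** * Signs of the Gregory coefficients *)

(** The coefficients (-1)^n G_n of -x / log (1 - x) are inverse to the
    coefficients 1 / (n + 1) of - log (1 - x) / x, whose positivity makes this
    form of the defining relation the useful one. *)
Lemma gregory_recurrence n :
  \sum_(k < n.+1) (-1) ^+ k * gregory k / (n.+1 - k)%N%:R = (n == 0)%:R.
Proof.
(* Only the defining relation of the Gregory coefficients matters here. *)
move: gregory gregoryP => g gP.
have := congr1 (fun a : fps => (-1) ^+ n * a n.+1) gP.
rewrite /fps_mul big_ord_recr /= subnn mulr0 addr0 /fps_X mulr_sumr eqSS.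
have -> : (-1) ^+ n * (n == 0)%:R = (n == 0)%:R :> rat.
  by case: n => [|n]; rewrite ?mulr0 // mulr1.
move=> <-; apply: eq_bigr => k _; rewrite subSn -1?ltnS //= !mulrA; congr (_ / _).
rewrite [RHS]mulrAC -exprD; congr (_ * _).
by rewrite -signr_odd -[RHS]signr_odd; congr (_ ^+ nat_of_bool _); have := ltn_ord k; lia.
Qed.

(** Kaluza's theorem on the reciprocal c of a series a with positive
    log-convex coefficients. Combining the relations at n + 1 and n + 2 so that
    the contribution of c_0 cancels expresses c_(n+2) as a combination of the
    earlier c_k with weights a_(n+2) a_(n-k) - a_(n+1) a_(n+1-k) >= 0. *)
Lemma kaluza_sign (R : realFieldType) (a c : nat -> R) :
  (forall n, 0 < a n) ->
  (forall m n, (m <= n)%N -> a m.+1 * a n <= a n.+1 * a m) ->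
  0 <= c 0 ->
  (forall n, \sum_(k < n.+2) c k * a (n.+1 - k)%N = 0) ->
  forall n, c n.+1 <= 0.
Proof.
move=> a_gt0 a_logconvex c0 ca n; elim/ltn_ind: n => -[_|n IHn].
  have := ca 0%N; rewrite big_ord_recr big_ord1 /= => /eqP.
  rewrite addrC addr_eq0 => /eqP e.
  by rewrite -(pmulr_rle0 _ (a_gt0 0%N)) mulrC e oppr_le0 mulr_ge0 // ltW.
rewrite -(pmulr_rle0 _ (mulr_gt0 (a_gt0 0%N) (a_gt0 n.+1))).
pose U := \sum_(k < n.+1) c k.+1 * a (n - k)%N.
pose V := \sum_(k < n.+1) c k.+1 * a (n.+1 - k)%N.
have eU : c 0%N * a n.+1 + U = 0.
  by rewrite -(ca n) big_ord_recl.
have eV : c 0%N * a n.+2 + (V + c n.+2 * a 0%N) = 0.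
  by rewrite -(ca n.+1) big_ord_recl big_ord_recr /= subnn.
have -> : a 0%N * a n.+1 * c n.+2 = a n.+2 * U - a n.+1 * V.
  apply: subr0_eq; transitivity (a n.+1 * 0 - a n.+2 * 0); last by rewrite !mulr0 subrr.
  by rewrite -{1}eV -eU; ring.
rewrite !mulr_sumr -sumrB; apply: sumr_le0 => k _.
rewrite ![_ * (c _ * _)]mulrCA -mulrBr mulr_le0_ge0 ?IHn ?ltn_ord //.
rewrite subr_ge0 [a n.+1 * _]mulrC subSn -1?ltnS //.
by rewrite a_logconvex // leqW // leq_subr.
Qed.

Lemma gregory_sign n : (0 < n)%N -> `|gregory n| = - ((-1) ^+ n * gregory n).
Proof.
case: n => // n _.
have : (-1) ^+ n.+1 * gregory n.+1 <= 0.
  apply: (@kaluza_sign rat (fun n => n.+1%:R^-1) (fun n => (-1) ^+ n * gregory n)).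
  - by move=> m; rewrite invr_gt0 ltr0n.
  - move=> i j leij; rewrite -!invfM lef_pV2 ?posrE ?mulr_gt0 ?ltr0n //.
    by rewrite -!natrM ler_nat; nia.
  - by rewrite gregory0.
  - move=> m; apply: etrans (gregory_recurrence m.+1).
    by apply: eq_bigr => k _; rewrite -subSn -1?ltnS.
by move=> /ler0_norm <-; rewrite normrM normrX normrN1 expr1n mul1r.
Qed.

(** * A closed form over the rationals for the truncated sum *)

Lemma falling_coef0 (R : idomainType) n : (falling R n.+1)`_0 = 0.
Proof. by rewrite -horner_coef0 /falling horner_prod big_ord_recl hornerXsubC subrr mul0r. Qed.

Lemma falling_coef_lead (R : idomainType) n : (falling R n)`_n = 1.
Proof. by rewrite -[RHS](monicP (monic_falling R n)) lead_coefE size_falling. Qed.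

(** With p = m + 2, the left side is the recurrence at index p without its
    first term 1 / p and its last term G_(p-1). The integral formula for G_(p-1)
    contains a second multiple of 1 / p, from the leading coefficient of the
    falling factorial; together they make the Wilson quotient, and no other
    denominator on the right is divisible by p. *)
Lemma gregory_truncated_sum m : odd m ->
  \sum_(i < m) (-1) ^+ i.+1 * gregory i.+1 / (m.+1 - i)%N%:R =
  - ((m.+1`!.+1%:R / m.+2%:R
      + \sum_(i < m) (falling rat m.+1)`_i.+1 / i.+2%:R) / m.+1`!%:R).
Proof.
move=> odd_m; have := gregory_recurrence m.+1.
rewrite big_ord_recl gregory0 mul1r subn0 big_ord_recr /= addrA.
rewrite subSnn divr1 gregory_falling (int01E _ (falling rat m.+1) m.+2) ?size_falling //.
rewrite big_ord_recl falling_coef0 mul0r add0r.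
rewrite [X in _ + _ * (X / _)]big_ord_recr /= falling_coef_lead.
rewrite -signr_odd /= odd_m expr0 mul1r => E.
apply/eqP; rewrite -addr_eq0 -[X in _ == X]E -subr_eq0; apply/eqP.
have f0 : m.+1`!%:R != 0 :> rat by rewrite pnatr_eq0 -lt0n fact_gt0.
have m0 : m.+2%:R != 0 :> rat by rewrite pnatr_eq0.
rewrite -[m.+1`!.+1]addn1 natrD.
set f := m.+1`!%:R in f0 *; set q := m.+2%:R in m0 *.
rewrite /bump /=; under [X in _ - (_ + X + _) = _]eq_bigr do rewrite add1n subSS.

set A := \sum_(i < m) _; set B := \sum_(i < m) _.
clearbody A B f q; field; exact/andP.
Qed.

(** Divide the expansion of 2^p - 2 (p = m + 2) by p termwise, using
    C(p, j + 1) / p = C(p - 1, j) / (j + 1). *)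
Lemma sum_binom_div m :
  (2 ^+ m.+1 - 1) *+ 2 / m.+2%:R = \sum_(j < m.+1) 'C(m.+1, j)%:R / j.+1%:R :> rat.
Proof.
have m0 : m.+2%:R != 0 :> rat by rewrite pnatr_eq0.
apply: (mulIf m0); rewrite divfK // mulr_suml.
have E : 2 ^+ m.+2 = \sum_(i < m.+3) 'C(m.+2, i)%:R :> rat.
  by rewrite -[2]/(1 + 1) exprDn; apply: eq_bigr => i _; rewrite !expr1n mul1r.
transitivity (2 ^+ m.+2 - 2 : rat); first by rewrite [in RHS]exprS; ring.
rewrite E big_ord_recl big_ord_recr /= bin0 binn.
rewrite addrCA -addrA -natrD subrr addr0.
apply: eq_bigr => j _; rewrite /bump add1n [RHS]mulrAC -natrM mulnC.
by rewrite (mul_bin_diag m.+2) natrM mulrC mulKf ?pnatr_eq0.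
Qed.

(** * Reduction of p-integral rationals modulo p *)

(** The graph of the reduction map from Z_(p) to Z/pZ. As a relation it carries
    p-integrality along with the value, whereas [redp] is a ring morphism only
    on the p-integral rationals. *)
Definition reduces (p : nat) (x : rat) (a : 'F_p) : Prop :=
  exists m n : int,
    [/\ n%:~R != 0 :> 'F_p, x = m%:~R / n%:~R & a = m%:~R / n%:~R].

Lemma redp_reduces p x a : reduces p x a -> redp p x = a.
Proof. by case=> m [n [n0 -> ->]]; exact: redp_frac. Qed.

Lemma reduces_int p (m : int) : reduces p m%:~R m%:~R.
Proof. by exists m, 1; rewrite !divr1 oner_neq0. Qed.

Lemma reduces_nat p (n : nat) : reduces p n%:R n%:R.
Proof. exact: (reduces_int p n). Qed.

Lemma intr_neq0_of_Fp p (n : int) : n%:~R != 0 :> 'F_p -> n%:~R != 0 :> rat.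
Proof. by rewrite intr_eq0; apply: contraNneq => ->. Qed.

Lemma reducesD p x y a b :
  reduces p x a -> reduces p y b -> reduces p (x + y) (a + b).
Proof.
case=> m [n [n0 -> ->]] [k [l [l0 -> ->]]].
exists (m * l + k * n), (n * l); rewrite !rmorphD !rmorphM /= mulf_neq0 //.
by rewrite !addf_div ?(intr_neq0_of_Fp p).
Qed.

Lemma reducesM p x y a b :
  reduces p x a -> reduces p y b -> reduces p (x * y) (a * b).
Proof.
case=> m [n [n0 -> ->]] [k [l [l0 -> ->]]].
by exists (m * k), (n * l); rewrite !rmorphM /= mulf_neq0 // !mulf_div.
Qed.

Lemma reducesN p x a : reduces p x a -> reduces p (- x) (- a).
Proof.
by case=> m [n [n0 -> ->]]; exists (- m), n; rewrite !rmorphN /= !mulNr.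
Qed.

Lemma reduces_natV p (n : nat) : n%:R != 0 :> 'F_p -> reduces p n%:R^-1 n%:R^-1.
Proof. by move=> n0; exists 1, n%:Z; rewrite !mul1r. Qed.

Lemma reduces_sum p (I : Type) (r : seq I) (x : I -> rat) (a : I -> 'F_p) :
  (forall i, reduces p (x i) (a i)) ->
  reduces p (\sum_(i <- r) x i) (\sum_(i <- r) a i).
Proof.
move=> xa; apply: (big_ind2 (reduces p)); first exact: (reduces_nat p 0).
  by move=> x1 a1 x2 a2; exact: reducesD.
by move=> i _; apply: xa.
Qed.

Lemma reduces_sign p n : reduces p ((-1) ^+ n) ((-1) ^+ n).
Proof. by have := reduces_int p ((-1) ^+ n); rewrite !rmorphXn !rmorphN1. Qed.

Lemma Fp_nat_neq0 p n : prime p -> (0 < n < p)%N -> n%:R != 0 :> 'F_p.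
Proof.
move=> p_pr /andP[n0 np].
by rewrite -(dvdn_pcharf (pchar_Fp p_pr)) gtnNdvd.
Qed.

Lemma Fp_subr p n : prime p -> (n <= p)%N -> (p - n)%N%:R = - n%:R :> 'F_p.
Proof. by move=> p_pr le_np; rewrite natrB // pchar_Fp_0 // sub0r. Qed.

Lemma reduces_falling p n j : reduces p (falling rat n)`_j (falling 'F_p n)`_j.
Proof.
rewrite -(map_falling _ _ (intr : int -> rat)) -(map_falling _ _ (intr : int -> 'F_p)).
by rewrite !coef_map; exact: reduces_int.
Qed.

Lemma fact_Fp_neq0 p n : prime p -> (n < p)%N -> n`!%:R != 0 :> 'F_p.
Proof.
move=> p_pr; elim: n => [|n IHn] np; first exact: oner_neq0.
by rewrite factS natrM mulf_neq0 ?IHn ?Fp_nat_neq0 // ltnW.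
Qed.

(** The integral formula only divides by integers at most n + 1. *)
Lemma reduces_gregory p n : prime p -> (n.+1 < p)%N ->
  reduces p (gregory n) (int01 (falling 'F_p n) / n`!%:R).
Proof.
move=> p_pr np; rewrite gregory_falling; apply: reducesM; last first.
  by apply/reduces_natV/fact_Fp_neq0 => //; exact: ltnW.
rewrite !(@int01E _ _ n.+1) ?size_falling //.
apply: reduces_sum => j; have jn := ltn_ord j.
apply: reducesM; first exact: reduces_falling.
by apply/reduces_natV/Fp_nat_neq0 => //=; apply: leq_ltn_trans np.
Qed.

(** Both sides are the product of X - a over all a in Z/pZ. *)
(** * Congruences modulo p for falling factorials, binomials and factorials *)

Lemma falling_Fp p : prime p -> falling 'F_p p = 'X^p - 'X.
Proof.
move=> p_pr; have := finField_genPoly 'F_p; rewrite card_Fp // => ->.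
transitivity (falling 'F_p (Zp_trunc (pdiv p)).+2); first by rewrite Fp_cast.
by apply: eq_bigr => i _; rewrite natr_Zp.
Qed.

(** Modulo p the falling factorial of length p - 1 is (X^p - X) / (X + 1). *)
Lemma falling_Fp_coef p j : prime p -> (0 < j < p)%N ->
  (falling 'F_p p.-1)`_j = (-1) ^+ j.
Proof.
move=> p_pr; have p0 := prime_gt0 p_pr.
(* Compare coefficients in (X + 1) * falling (p - 1) = X^p - X. *)
have E i : (i.+1 < p)%N -> (falling 'F_p p.-1)`_i + (falling 'F_p p.-1)`_i.+1 = - (i == 0%N)%:R.
  move=> ip; have /(congr1 (fun P : {poly 'F_p} => P`_i.+1)) := falling_Fp p p_pr.
  rewrite -[in X in falling _ X](prednK p0) fallingS.
  have -> : p.-1%:R = -1 :> 'F_p by rewrite -subn1 Fp_subr.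
  rewrite rmorphN opprK mulrDl mul1r.
  rewrite coefD coefXM /= coefB coefXn coefX eqSS => ->.
  by rewrite ltn_eqF // sub0r.
have F0 : (falling 'F_p p.-1)`_0 = 0.
  by case: p p_pr {p0 E} => [|[|p]] // p_pr; rewrite falling_coef0.
case: j => // j /= jp; elim: j jp => [|j IHj] jp.
  by rewrite -[LHS]add0r -{1}F0 E.
apply: (addrI (falling 'F_p p.-1)`_j.+1); rewrite E // oppr0.
by rewrite IHj 1?ltnW // [_ ^+ j.+2]exprS mulN1r subrr.
Qed.

(** Adjacent entries of row p - 1 of Pascal's triangle add up to an entry of
    row p, which vanishes modulo p. *)
Lemma binom_Fp p j : prime p -> (j < p)%N -> 'C(p.-1, j)%:R = (-1) ^+ j :> 'F_p.
Proof.
move=> p_pr; elim: j => [|j IHj] jp; first by rewrite bin0.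
apply: (addIr 'C(p.-1, j)%:R); rewrite -natrD -binS prednK ?prime_gt0 //.
rewrite [in RHS]IHj 1?ltnW // exprS mulN1r addNr.
by apply/eqP; rewrite -(dvdn_pcharf (pchar_Fp p_pr)) prime_dvd_bin.
Qed.

Lemma fact_pred_Fp p : prime p -> p.-1`!%:R = -1 :> 'F_p.
Proof.
move=> p_pr; apply/eqP; rewrite -addr_eq0 natr1.
by rewrite -(dvdn_pcharf (pchar_Fp p_pr)) -Wilson // prime_gt1.
Qed.

Lemma wilson_quotient_rat p : prime p ->
  (wilson_quotient p)%:R = p.-1`!.+1%:R / p%:R :> rat.
Proof.
by move=> p_pr; rewrite -wilson_quotientK // natrM mulfK // pnatr_eq0 -lt0n prime_gt0.
Qed.

(** * The congruence at each odd prime *)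

Lemma reduces_fermat_quotient2 p : prime p -> (2 < p)%N ->
  reduces p (fermat_quotient p 2) ((\sum_(j < p.-1) (-1) ^+ j / j.+1%:R) / 2).
Proof.
move=> p_pr p2.
have -> : fermat_quotient p 2 = (\sum_(j < p.-1) 'C(p.-1, j)%:R / j.+1%:R) / 2%:R.
  case: p p_pr p2 => [|[|m]] // _ _; rewrite /fermat_quotient -sum_binom_div /=.
  by rewrite -[(_ - _) *+ 2]mulr_natr [in RHS]mulrAC mulfK.
apply: reducesM; last by apply: reduces_natV; exact: Fp_nat_neq0.
apply: reduces_sum => j; have jp := ltn_ord j.
rewrite -binom_Fp //; last by lia.
by apply: reducesM; [exact: reduces_nat | apply/reduces_natV/Fp_nat_neq0; lia].
Qed.

(** Modulo p the denominator n may be traded for n - p, which turns the sum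
    into the one evaluated over the rationals by [gregory_truncated_sum]. *)
Lemma redp_gregory_sum p : prime p -> (2 < p)%N ->
  redp p (\sum_(1 <= n < p.-1) `|gregory n| / n%:R) =
  (wilson_quotient p)%:R + \sum_(j < p.-2) (-1) ^+ j.+1 / j.+2%:R.
Proof.
move=> p_pr p2.
pose g n := int01 (falling 'F_p n) / n`!%:R.
pose s := \sum_(i < p.-2) - ((-1) ^+ i.+1 * g i.+1 / i.+1%:R).
have -> : redp p (\sum_(1 <= n < p.-1) `|gregory n| / n%:R) = s.
  apply: redp_reduces; rewrite -[p.-1]prednK ?big_add1 ?big_mkord /=; last by lia.
  apply: reduces_sum => i; have ip := ltn_ord i.
  rewrite gregory_sign // mulNr; apply/reducesN/reducesM; last first.
    by apply/reduces_natV/Fp_nat_neq0 => //; lia.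
  apply: reducesM; first exact: reduces_sign.
  by apply: reduces_gregory => //; lia.
have odd_m : odd p.-2 by have := even_prime p_pr; lia.
have pE : p = p.-2.+2 by lia.
(* The n-th terms of the two sums have the same image modulo p. *)
transitivity (redp p (\sum_(i < p.-2) (-1) ^+ i.+1 * gregory i.+1 / (p.-1 - i)%N%:R)).
  apply/esym/redp_reduces.
  apply: reduces_sum => i; have ip := ltn_ord i.
  rewrite -mulrN -invrN -Fp_subr //; last by lia.
  have -> : (p.-1 - i = p - i.+1)%N by lia.
  apply/reducesM; last by apply/reduces_natV/Fp_nat_neq0 => //; lia.
  apply: reducesM; first exact: reduces_sign.
  by apply: reduces_gregory => //; lia.
have -> : (p.-1 = p.-2.+1)%N by lia.
rewrite gregory_truncated_sum // -pE (_ : p.-2.+1 = p.-1); last by lia.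
rewrite -wilson_quotient_rat //.
apply: redp_reduces.
set t := (X in reduces _ _ X); have -> : t = - (t / p.-1`!%:R).
  by rewrite fact_pred_Fp // invrN1 mulrN1 opprK.
apply/reducesN/reducesM; last first.
  by apply/reduces_natV/fact_Fp_neq0 => //; lia.
apply: reducesD; first exact: reduces_nat.
apply: reduces_sum => i; have ip := ltn_ord i.
rewrite -falling_Fp_coef //; last by lia.
by apply: reducesM; [exact: reduces_falling | apply/reduces_natV/Fp_nat_neq0; lia].
Qed.

Theorem theorem2p4 : gammaM = gammaW + ellA 2 - 1 :> ringA.
Proof.
have mkAD a b : mkA (a + b) = mkA a + mkA b by exact: rmorphD.
rewrite /ellA ringA_scaleE /ratA /logA /gammaW -mkA1 -mkAM -mkAD -mkAB.
apply: (@mkA_eq_large 2) => p p2; have p_pr := valP p.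
rewrite redp_gregory_sum //.
rewrite -[RHS]/(_ + redp (val p) 2 * redp (val p) (fermat_quotient (val p) 2) - 1).
rewrite (redp_reduces _ _ _ (reduces_fermat_quotient2 _ p_pr p2)).
rewrite (redp_reduces _ _ _ (reduces_nat _ 2)) mulrC divfK; last exact: Fp_nat_neq0.
have -> : (val p).-1 = (val p).-2.+1 by lia.
rewrite big_ord_recl expr0 divr1 -addrA; congr (_ + _).
by rewrite [RHS]addrC addKr.
Qed.
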